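(* Let $A$ be a supercommutative algebra over $\mathbb{C}$, let $M$ be a supermodule for $A$, and let $n\in\mathbb{N}$. Let $C^n(A,M)$ denote the space of $n$-th super-Harrison cochains and let $\partial$ be the Hochschild coboundary map. Then for every $f\in C^n(A,M)$ one has $\partial f\in C^{n+1}(A,M)$.
   Context: All vector spaces are over $\mathbb{C}$; $\mathbb{N}=\{0,1,2,\dots\}$, $\mathbb{Z}_2=\mathbb{Z}/2\mathbb{Z}$. A supercommutative algebra is a $\mathbb{Z}_2$-graded vector space $A=A^0\oplus A^1$ with an associative bilinear multiplication satisfying $A^i\cdot A^j\subseteq A^{i+j}$ and $b\cdot a=(-1)^{|a||b|}a\cdot b$ for all homogeneous $a,b$, where $|a|=i$ (the parity of $a$) if $a\in A^i$. Elements of $A^0$ are even, elements of $A^1$ are odd. A supermodule for $A$ is a $\mathbb{Z}_2$-graded vector space $M=M^0\oplus M^1$ which is a module for the associative algebra $A$ with $A^i\cdot M^j\subseteq M^{i+j}$. It is regarded as an $A$-bimodule with right action $m\cdot a=(-1)^{|a||m|}a\cdot m$ for homogeneous $a\in A$, $m\in M$. Hochschild coboundary: for a linear map $f:A^{\otimes n}\to M$, $\partial f:A^{\otimes(n+1)}\to M$ is $$(\partial f)(a_1\otimes\cdots\otimes a_{n+1})=a_1f(a_2\otimes\cdots\otimes a_{n+1})+\sum_{i=1}^n(-1)^if(a_1\otimes\cdots\otimes a_ia_{i+1}\otimes\cdots\otimes a_{n+1})+(-1)^{n+1}f(a_1\otimes\cdots\otimes a_n)a_{n+1}.$$ Shuffles: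 for $1\le p\le n-1$, $J_p(1,\dots,n)$ is the set of permutations $\sigma$ of $\{1,\dots,n\}$ with $\sigma(1)<\cdots<\sigma(p)$ and $\sigma(p+1)<\cdots<\sigma(n)$. Sign of odd elements: fix homogeneous $a_1,\dots,a_n\in A$, the odd ones being $a_{\alpha_1},\dots,a_{\alpha_k}$ with $\alpha_1<\cdots<\alpha_k$. For a permutation $\tau$ of $\{1,\dots,n\}$ let $\beta_1<\cdots<\beta_k$ be the positions such that $a_{\tau(\beta_1)},\dots,a_{\tau(\beta_k)}$ are odd, and let $\tau^o$ be the permutation of $\{\alpha_1,\dots,\alpha_k\}$ given by $\tau^o(\alpha_m)=\tau(\beta_m)$. Then $(-1)^{\tau^o}$ denotes the signature of $\tau^o$ (it depends on $\tau$ and on the parities of the $a_i$), while $(-1)^\tau$ denotes the ordinary signature of $\tau$. Super shuffle sum: for linear $f:A^{\otimes n}\to M$ and $1\le p\le n-1$, $su_{n,p}f:A^{\otimes n}\to M$ is the linear map defined on homogeneous elements by $$(su_{n,p}f)(a_1\otimes\cdots\otimes a_n)=\sum_{\sigma\in J_p(1,\dots,n)}(-1)^\sigma(-1)^{(\sigma^{-1})^o}f(a_{\sigma^{-1}(1)}\otimes\cdots\otimes a_{\sigma^{-1}(n)}).$$ A linear map $f:A^{\otimes n}\to M$ is parity-preserving if $|f(a_1\otimes\cdots\otimes a_n)|=|a_1|+\cdots+|a_n|\in\mathbb{Z}_2$ for homogeneous $a_i$ (i.e. $f(a_1\otimes\cdots\otimes a_n)\in M^{|a_1|+\cdots+|a_n|}$).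 The space of super-Harrison cochains is $$C^n(A,M)=\{f:A^{\otimes n}\to M \text{ linear}: f\text{ is parity-preserving and } su_{n,p}f=0\text{ for }p=1,\dots,n-1\}.$$ *)

(* Defs.v *)
From mathcomp Require Import all_boot all_order all_algebra all_fingroup.
From mathcomp Require Export reals complex.

Set Implicit Arguments.
Unset Strict Implicit.
Unset Printing Implicit Defensive.

Import GRing.Theory.
Local Open Scope ring_scope.

(* Parities are booleans ([false] = even, [true] = odd), and addition in Z/2
   is [addb], written [(+)].                                                  *)

(* An internal direct sum decomposition V = V^0 (+) V^1.  The components
   [part i v] are determined by the two subspaces; they are stored in order to
   have them as functions.                                                    *)
Record grading (K : fieldType) (V : lmodType K) := Grading {
  grade :> bool -> submodClosed V;
  part : bool -> V -> V;
  part_in : forall i v, part i v \in grade i;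
  part_sum : forall v, v = part false v + part true v;
  grade_direct : forall v, v \in grade false -> v \in grade true -> v = 0
}.

(* The library's algebra structures all have a unit, which is not required
   here, so the product is an associative bilinear map.                       *)
Record superAlgebra (K : fieldType) := SuperAlgebra {
  sa_sort :> lmodType K;
  sa_grade : grading sa_sort;
  sa_mul : {bilinear sa_sort -> sa_sort -> sa_sort};
  sa_mulA : forall a b c, sa_mul a (sa_mul b c) = sa_mul (sa_mul a b) c;
  sa_mul_grade : forall i j a b,
    a \in sa_grade i -> b \in sa_grade j -> sa_mul a b \in sa_grade (i (+) j);
  sa_supercomm : forall i j a b, a \in sa_grade i -> b \in sa_grade j ->
    sa_mul b a = (-1) ^+ (i && j) *: sa_mul a b
}.

Record superModule (K : fieldType) (A : superAlgebra K) := SuperModule {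
  sm_sort :> lmodType K;
  sm_grade : grading sm_sort;
  sm_act : {bilinear A -> sm_sort -> sm_sort};
  sm_actA : forall a b m, sm_act a (sm_act b m) = sm_act (sa_mul A a b) m;
  sm_act_grade : forall i j a m, a \in sa_grade A i -> m \in sm_grade j ->
    sm_act a m \in sm_grade (i (+) j)
}.

Section Cochains.

Variables (K : fieldType) (A : superAlgebra K) (M : superModule A).

(* The bilinear extension of m . a = (-1)^(|a||m|) a . m; see [sm_ractE].     *)
Definition sm_ract (m : M) (a : A) : M :=
  \sum_(i : bool) \sum_(j : bool)
    (-1) ^+ (i && j) *: sm_act M (part (sa_grade A) i a) (part (sm_grade M) j m).

Definition upd n (a : {ffun 'I_n -> A}) (i : 'I_n) (x : A) : {ffun 'I_n -> A} :=
  [ffun j => if j == i then x else a j].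

(* A linear map from the n-th tensor power of A to M is represented by the
   corresponding multilinear map, a function of a_1, ..., a_n (indexed from 0);
   for n = 0 it is an element of M.                                           *)
Definition multilinear n (f : {ffun 'I_n -> A} -> M) : Prop :=
  forall a i c x y,
    f (upd a i (c *: x + y)) = c *: f (upd a i x) + f (upd a i y).

Definition parity_preserving n (f : {ffun 'I_n -> A} -> M) : Prop :=
  forall (e : {ffun 'I_n -> bool}) (a : {ffun 'I_n -> A}),
    (forall i, a i \in sa_grade A (e i)) ->
    f a \in sm_grade M (\big[addb/false]_(i < n) e i).

(* For i counted from 0:
   (a_0, ..., a_n) |-> (a_0, ..., a_i a_(i+1), ..., a_n).                     *)
Definition contract n (i : 'I_n) (a : {ffun 'I_n.+1 -> A}) :
    {ffun 'I_n -> A} :=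
  [ffun j : 'I_n => if (j < i)%N then a (widen_ord (leqnSn n) j)
    else if j == i then sa_mul A (a (widen_ord (leqnSn n) i)) (a (lift ord0 i))
    else a (lift ord0 j)].

Definition coboundary n (f : {ffun 'I_n -> A} -> M) :
    {ffun 'I_n.+1 -> A} -> M :=
  fun a =>
    sm_act M (a ord0) (f [ffun j => a (lift ord0 j)])
    + \sum_(i < n) (-1) ^+ i.+1 *: f (contract i a)
    + (-1) ^+ n.+1 *:
        sm_ract (f [ffun j => a (widen_ord (leqnSn n) j)]) (a ord_max).

(* [J_p(1, ..., n)], with the positions counted from 0.                       *)
Definition shuffle n (p : nat) (s : 'S_n) : bool :=
  [forall i : 'I_n, forall j : 'I_n,
    ((i < j < p) || (p <= i < j))%N ==> (s i < s j)%N].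

Section OddPart.

(* [e i] is the parity of a_i.  Both lists below are increasing.              *)
Variables (n : nat) (e : {ffun 'I_n -> bool}) (t : 'S_n).

Definition alphas : seq 'I_n := [seq i <- enum 'I_n | e i].
Definition betas : seq 'I_n := [seq i <- enum 'I_n | e (t i)].

(* alpha_m |-> t beta_m, extended by the identity to the even indices, which
   does not change the signature.                                             *)
Definition odd_part_fun (i : 'I_n) : 'I_n :=
  if e i then t (nth i betas (index i alphas)) else i.

Lemma mem_alphas i : (i \in alphas) = e i.
Proof. by rewrite mem_filter mem_enum andbT. Qed.

Lemma mem_betas i : (i \in betas) = e (t i).
Proof. by rewrite mem_filter mem_enum andbT. Qed.

Lemma size_betas : size betas = size alphas.
Proof.
have u1 : uniq [seq t i | i <- betas].
  by rewrite (map_inj_uniq perm_inj) filter_uniq ?enum_uniq.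
have u2 : uniq alphas by rewrite filter_uniq ?enum_uniq.
rewrite -(size_map t); apply/perm_size; apply: uniq_perm => // i.
rewrite mem_alphas; apply/mapP/idP => [[j + ->]|ei]; first by rewrite mem_betas.
by exists ((t^-1)%g i); rewrite ?mem_betas permKV.
Qed.

Lemma odd_part_fun_odd i : e (odd_part_fun i) = e i.
Proof.
rewrite /odd_part_fun; case: ifP => ei; last by [].
by rewrite -mem_betas mem_nth // size_betas index_mem mem_alphas.
Qed.

Lemma odd_part_fun_inj : injective odd_part_fun.
Proof.
move=> i j eij.
have eE : e j = e i by rewrite -odd_part_fun_odd -eij odd_part_fun_odd.
move: eij; rewrite /odd_part_fun eE; case: ifP => // ei /perm_inj.
have lt_k k : e k -> (index k alphas < size betas)%N.
  by move=> ek; rewrite size_betas index_mem mem_alphas.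
have ub : uniq betas by rewrite filter_uniq ?enum_uniq.
rewrite (set_nth_default i j) ?lt_k ?eE // => /eqP.
rewrite nth_uniq ?lt_k ?eE // => /eqP E.
have ia : i \in alphas by rewrite mem_alphas.
have ja : j \in alphas by rewrite mem_alphas eE.
by rewrite -(nth_index i ia) E nth_index.
Qed.

Definition odd_part : 'S_n := perm odd_part_fun_inj.

Lemma odd_part_on : perm_on [set i | e i] odd_part.
Proof.
apply/subsetP => i; rewrite !inE permE /odd_part_fun.
by case: ifP => //; rewrite eqxx.
Qed.

End OddPart.

(* The shuffle sum on homogeneous a_i of parity [e i].                        *)
Definition su_homog n (p : nat) (f : {ffun 'I_n -> A} -> M)
    (e : {ffun 'I_n -> bool}) (a : {ffun 'I_n -> A}) : M :=
  \sum_(s : 'S_n | shuffle p s)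
    ((-1) ^+ s * (-1) ^+ odd_part e (s^-1)%g) *: f [ffun i => a ((s^-1)%g i)].

(* Its multilinear extension; see [suE] and [su_multilinear].                 *)
Definition su n (p : nat) (f : {ffun 'I_n -> A} -> M) :
    {ffun 'I_n -> A} -> M :=
  fun a => \sum_(e : {ffun 'I_n -> bool})
    su_homog p f e [ffun i => part (sa_grade A) (e i) (a i)].

Definition super_harrison n (f : {ffun 'I_n -> A} -> M) : Prop :=
  [/\ multilinear f, parity_preserving f
    & forall p, (1 <= p <= n.-1)%N -> forall a, su p f a = 0].

End Cochains.

Section GradingTheory.

Variables (K : fieldType) (V : lmodType K) (G : grading V).

Lemma gradeB i (u v : V) : u \in G i -> v \in G i -> u - v \in G i.
Proof. by move=> uG vG; rewrite -scaleN1r rpredD ?rpredZ. Qed.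

Lemma part_unique (u w : V) : u \in G false -> w \in G true ->
  (part G false (u + w) = u) * (part G true (u + w) = w).
Proof.
move=> uG wG; set v := u + w.
have E : part G false v - u = w - part G true v.
  apply/eqP; rewrite subr_eq addrAC -subr_eq opprK.
  by rewrite -part_sum addrC.
have z : part G false v - u = 0.
  apply: (@grade_direct _ _ G); first by rewrite gradeB ?part_in //.
  by rewrite E gradeB ?part_in //.
split; first by apply/eqP; rewrite -subr_eq0 z.
by apply/esym/eqP; rewrite -subr_eq0 -E z.
Qed.

Lemma part_homog i j (v : V) : v \in G j ->
  part G i v = if i == j then v else 0.
Proof.
have v0 k : 0 \in G k by apply: rpred0.
case: j => vG.
  by have := part_unique (v0 false) vG; rewrite add0r; case: i => -[].
by have := part_unique vG (v0 true); rewrite addr0; case: i => -[].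
Qed.

Lemma part_linear i : linear (part G i).
Proof.
move=> c u v.
have := @part_unique (c *: part G false u + part G false v)
                     (c *: part G true u + part G true v).
rewrite addrACA -scalerDr -!part_sum.
by case; rewrite ?rpredD ?rpredZ ?part_in //; case: i.
Qed.

End GradingTheory.

Section Characterizations.

Variables (K : fieldType) (A : superAlgebra K) (M : superModule A).

Lemma sm_ractE i j (a : A) (m : M) :
  a \in sa_grade A i -> m \in sm_grade M j ->
  sm_ract m a = (-1) ^+ (i && j) *: sm_act M a m.
Proof.
move=> aG mG; rewrite /sm_ract (bigD1 i) //= (bigD1 j) //= !big1 ?addr0.
- by rewrite (part_homog _ aG) (part_homog _ mG) !eqxx.
- move=> k /negPf ki; apply: big1 => l _.
  by rewrite (part_homog _ aG) ki linear0l scaler0.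
- by move=> l /negPf lj; rewrite (part_homog _ mG) lj linear0r scaler0.
Qed.

Lemma upd_id n (a : {ffun 'I_n -> A}) i : upd a i (a i) = a.
Proof. by apply/ffunP => j; rewrite ffunE; case: eqP => [->|]. Qed.

Lemma multilinear0 n (f : {ffun 'I_n -> A} -> M)
    (a : {ffun 'I_n -> A}) i : multilinear f -> a i = 0 -> f a = 0.
Proof.
move=> fl ai0; have := fl a i (-1) 0 0; rewrite scaler0 add0r scaleN1r addNr.
by rewrite -[in upd _ _ _]ai0 upd_id.
Qed.

Lemma suE n p (f : {ffun 'I_n -> A} -> M) (e : {ffun 'I_n -> bool})
    (a : {ffun 'I_n -> A}) :
  multilinear f -> (forall i, a i \in sa_grade A (e i)) ->
  su p f a = su_homog p f e a.
Proof.
move=> fl aG; rewrite /su (bigD1 e) //= big1 ?addr0.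
  congr su_homog; apply/ffunP => i.
  by rewrite ffunE (part_homog _ (aG i)) eqxx.
move=> e' /eqP ne; have [i ei] : exists i, e' i != e i.
  apply/existsP; rewrite -[X in is_true X]negbK negb_exists.
  apply/negP => /forallP E; apply: ne; apply/ffunP => i.
  by apply/eqP; rewrite -[_ == _]negbK.
apply: big1 => s _; rewrite (@multilinear0 _ f _ (s i)) ?scaler0 //.
by rewrite !ffunE permK (part_homog _ (aG i)) (negPf ei).
Qed.

Lemma su_multilinear n p (f : {ffun 'I_n -> A} -> M) :
  multilinear f -> multilinear (su p f).
Proof.
move=> fl a i c x y; rewrite /su scaler_sumr -big_split /=.
apply: eq_bigr => e _; rewrite /su_homog scaler_sumr -big_split /=.
apply: eq_bigr => s _; set b := [ffun j => part (sa_grade A) (e (s^-1 j)%g) (a (s^-1 j)%g)].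
have E z : [ffun j => [ffun k => part (sa_grade A) (e k) (upd a i z k)] ((s^-1)%g j)]
         = upd b (s i) (part (sa_grade A) (e i) z).
  apply/ffunP => j; rewrite !ffunE (canF_eq (permKV s)).
  by case: eqP => // ->; rewrite permK.
by rewrite !E part_linear fl scalerDr !scalerA [_ * c]mulrC.
Qed.

End Characterizations.

(* Main.v *)
Require Import Defs.
From mathcomp Require Import all_boot all_order all_algebra.
From mathcomp Require Import all_fingroup.
From mathcomp Require Import zify.

(** The signed shuffle product and the bar differential on the tensor coalgebra
of [A] are compatible: when [A] is supercommutative, the differential
[[a_1 | ... | a_n] |-> \sum_i +/- [a_1 | ... | a_i a_(i+1) | ... | a_n]] is a
derivation of the shuffle product.  The theorem is the dual of this fact, with
the two outer terms of the Hochschild coboundary treated separately.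

The work is done on words, i.e. lists of pairs (parity, element).  Moving a
letter [y] to the left past a letter [x] contributes [-(-1)^(|x||y|)], the
product of the signature and of the Koszul sign.  The shuffle sum [sh u v F] of
a function [F] of words is defined by recursion on the first letter of the
shuffled word.

- [sh_bar] is the derivation property: shuffling the inner part of the
  coboundary of [F] gives the sum of the same inner part applied to
  [u |-> sh u v F] and, with a sign, to [v |-> sh u v F].  The terms in which
  a letter of [u] is multiplied with a letter of [v] come in pairs [xy], [yx]
  and cancel by supercommutativity.  If [F] has vanishing proper shuffle sums,
  both remaining sums vanish: a word with a product to contract stays nonempty.
- In the outer terms the shuffle sum is split according to the letter that is
  taken out.  What is left is a proper shuffle sum, hence zero, unless that
  letter was the whole of [u] or of [v].  So only four terms survive: the
  letter [u] acts on [F v] from the left and from the right, and likewise for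
  [v].  By definition of the right action they cancel ([sh_word_coboundary]).

It remains to identify [sh] with the shuffle sum over permutations.  The
signature of a permutation is the parity of its number of inversions
([odd_perm_inv_sum]), and that of its odd part is the parity of the number of
inversions between odd letters ([odd_part_inv_sum]); hence the total sign is a
product of exchange signs over all inversions.  Splitting the shuffles by the
position whose letter comes first then gives the recursion that defines [sh]
([sum_shuffle]). *)

Set Implicit Arguments.
Unset Strict Implicit.
Unset Printing Implicit Defensive.

Import GRing.Theory.

(** * Signatures and inversions *)

Lemma lift_perm_ex n (s : 'S_n.+1) i : exists s', s = lift_perm i (s i) s'.
Proof.
pose f k := odflt k (unlift (s i) (s (lift i k))).
have fE k : s (lift i k) = lift (s i) (f k).
  rewrite /f; case: unliftP => [k' ->|/perm_inj /eqP] //=.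
  by rewrite eq_sym (negPf (neq_lift i k)).
have f_inj : injective f.
  by move=> k l E; apply: (@lift_inj _ i); apply: (@perm_inj _ s); rewrite !fE E.
exists (perm f_inj); apply/permP => k.
case: (unliftP i k) => [k'|] ->; last by rewrite lift_perm_id.
by rewrite lift_perm_lift permE fE.
Qed.

Lemma lift_perm_inj n (i j : 'I_n.+1) : injective (lift_perm i j).
Proof.
move=> s t E; apply/permP => k; apply: (@lift_inj _ j).
by rewrite -!(lift_perm_lift i) E.
Qed.

Lemma ltn_lift n (i : 'I_n.+1) (j k : 'I_n) :
  (lift i j < lift i k) = (j < k).
Proof. by rewrite !ltnNge /= leq_bump2. Qed.

Definition inv_sum n (s : 'S_n) (w : 'I_n -> 'I_n -> bool) : bool :=
  \big[addb/false]_(i : 'I_n) \big[addb/false]_(j : 'I_n)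
    [&& i < j, s j < s i & w i j].

Lemma eq_inv_sum n (s : 'S_n) w w' :
  w =2 w' -> inv_sum s w = inv_sum s w'.
Proof.
by move=> ww; apply: eq_bigr => i _; apply: eq_bigr => j _; rewrite ww.
Qed.

(** The index sent to the first place is inverted with exactly the indices
before it; the other inversions are those of the remaining permutation. *)
Lemma inv_sum_lift n (i0 : 'I_n.+1) (s : 'S_n) w :
  inv_sum (lift_perm i0 ord0 s) w =
  (\big[addb/false]_(k < n.+1 | k < i0) w k i0)
    (+) inv_sum s (fun i j => w (lift i0 i) (lift i0 j)).
Proof.
rewrite /inv_sum (bigD1_ord i0) //= big1 ?addFb => [|j _]; last first.
  by rewrite lift_perm_id andbF.
rewrite [in RHS]big_mkcond (bigD1_ord i0) //= ltnn addFb -big_split /=.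
apply: eq_bigr => i _; rewrite (bigD1_ord i0) //= lift_perm_id lift_perm_lift.
congr (_ (+) _); apply: eq_bigr => j _.
by rewrite lift_perm_lift -[bump i0 i < _]/(lift i0 i < lift i0 j) !ltn_lift.
Qed.

Lemma odd_perm_inv_sum n (s : 'S_n) :
  odd_perm s = inv_sum s (fun _ _ => true).
Proof.
elim: n s => [|n IH] s.
  by rewrite /inv_sum big_ord0 (_ : s = 1%g) ?odd_perm1 //; apply/permP => -[].
have [s' ->] := lift_perm_ex s ((s^-1)%g ord0); rewrite permKV.
rewrite odd_lift_perm inv_sum_lift addbF -IH; congr (_ (+) _).
rewrite -(big_ord_widen _ (fun=> true)) 1?ltnW // big_const_ord.
by elim: (nat_of_ord _) => //= k ->.
Qed.

(** A sum over ordered pairs modulo 2 depends only on how far the summand is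
from being symmetric. *)
Lemma addb_sum_unordered n (d : 'I_n -> 'I_n -> bool) :
  (forall i, d i i = false) ->
  \big[addb/false]_(i : 'I_n) \big[addb/false]_(j : 'I_n) d i j
  = \big[addb/false]_(i : 'I_n) \big[addb/false]_(j : 'I_n)
      ((i < j) && (d i j (+) d j i)).
Proof.
move=> d0.
have E (i j : 'I_n) : d i j = (i < j) && d i j (+) (j < i) && d i j.
  by case: ltngtP => [||/val_inj->]; rewrite ?addbF ?d0.
under eq_bigr => i _ do (under eq_bigr => j _ do rewrite E; rewrite big_split).
rewrite big_split /= [X in _ (+) X]exchange_big -big_split /=.
apply: eq_bigr => i _; rewrite -big_split; apply: eq_bigr => j _.
by rewrite /= -andb_addr.
Qed.

(** Inversions between a point of the support and a fixed point come in even
number: [{i, j}] is inverted iff exactly one of [i < j] and [s i < j] holds,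
and [s] only permutes the possible [i]. *)
Lemma odd_perm_support n (s : 'S_n) (e : 'I_n -> bool) :
  (forall i, e (s i) = e i) -> (forall i, ~~ e i -> s i = i) ->
  odd_perm s = inv_sum s (fun i j => e i && e j).
Proof.
move=> es fix_s.
pose d (i j : 'I_n) := [&& e i, ~~ e j & (i < j) (+) (s i < j)].
have d0 : \big[addb/false]_(i : 'I_n) \big[addb/false]_(j : 'I_n) d i j = false.
  rewrite exchange_big big1 // => j _.
  under eq_bigr => i _ do rewrite /d !andb_addr.
  rewrite big_split /= [X in X (+) _](reindex_inj (@perm_inj _ s)) /=.
  by under eq_bigr => i _ do rewrite es; rewrite addbb.
rewrite odd_perm_inv_sum -[RHS]addbF -d0 addb_sum_unordered => [|i]; last first.
  by rewrite /d; case: (e i).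
rewrite -big_split; apply: eq_bigr => i _.
rewrite -big_split; apply: eq_bigr => j _ /=.
case: ltnP => //= ij; rewrite /d ij (ltnNge j i) (ltnW ij) /=.
case ei: (e i); case ej: (e j); rewrite /= ?addbF ?andbT ?andbF //.
- rewrite (fix_s j) ?ej // -leqNgt ltn_neqAle.
  suff -> : j != s i :> nat by [].
  by apply/negP => /eqP /val_inj E; move: (es i); rewrite -E ei ej.
- by rewrite (fix_s i) ?ei.
- by rewrite !fix_s ?ei ?ej // ltnNge ltnW.
Qed.

Lemma ltn_nth_sorted n (l : seq 'I_n) x0 a b :
  sorted (fun i j : 'I_n => i < j) l ->
  a < size l -> b < size l -> (nth x0 l a < nth x0 l b) = (a < b).
Proof.
move=> sl al bl.
have tr : transitive (fun i j : 'I_n => i < j).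
  by move=> y x z; apply: ltn_trans.
have mono := sorted_ltn_nth tr x0 sl.
case: (ltngtP a b) => [ab|ba|->]; [exact: mono | | exact: ltnn].
by apply/negbTE; rewrite -leqNgt ltnW // mono.
Qed.

(** On the odd indices the odd part is [t] (here [t = s^-1]) precomposed with
the increasing bijection from [alphas] to [betas], so its inversions correspond
to the inversions of [t] between elements of [betas], and these are the
inversions of [s] between odd indices. *)
Lemma odd_part_inv_sum n (e : {ffun 'I_n -> bool}) (s : 'S_n) :
  odd_perm (odd_part e (s^-1)%g) = inv_sum s (fun i j => e i && e j).
Proof.
case: n e s => [|n] e s.
  by rewrite odd_perm_inv_sum /inv_sum !big_ord0.
set t := (s^-1)%g.
have sorted_enum (p : pred 'I_n.+1) :
    sorted (fun i j : 'I_n.+1 => i < j) [seq i <- enum 'I_n.+1 | p i].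
  apply: sorted_filter; first by move=> y x z; apply: ltn_trans.
  by have := iota_ltn_sorted 0 n.+1; rewrite -val_enum_ord sorted_map.
rewrite (@odd_perm_support _ _ e) => [|i|i ei].
- transitivity (\big[addb/false]_(i <- alphas e) \big[addb/false]_(j <- alphas e)
                  ((i < j) && (odd_part e t j < odd_part e t i))).
    rewrite big_filter big_enum_cond [RHS]big_mkcond; apply: eq_bigr => i _.
    rewrite big_filter big_enum_cond /= [in RHS]big_mkcond.
    case: (e i); last by rewrite big1 // => j _; rewrite !andbF.
    by apply: eq_bigr => j _; case: (e j); rewrite ?andbT ?andbF.
  transitivity (\big[addb/false]_(k <- betas e t) \big[addb/false]_(l <- betas e t)
                  ((k < l) && (t l < t k))).
    rewrite !(big_nth ord0) !big_mkord size_betas; apply: eq_bigr => a _.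
    rewrite !(big_nth ord0) !big_mkord size_betas; apply: eq_bigr => b _.
    have odd_nth c : c < size (alphas e) ->
        odd_part e t (nth ord0 (alphas e) c) = t (nth ord0 (betas e t) c).
      move=> lc; rewrite permE /odd_part_fun -mem_alphas mem_nth //.
      rewrite index_uniq ?filter_uniq -?enumT ?enum_uniq //.
      by rewrite (set_nth_default ord0) ?size_betas.
    by rewrite !odd_nth ?ltn_nth_sorted ?size_betas //; apply: sorted_enum.
  transitivity (\big[addb/false]_(i : 'I_n.+1) \big[addb/false]_(j : 'I_n.+1)
                  [&& j < i, s i < s j & e j && e i]); last exact: exchange_big.
  rewrite big_filter big_enum_cond (reindex_inj (@perm_inj _ s)) big_mkcond.
  apply: eq_bigr => i _; rewrite /= /t permK.
  case: (e i); last by rewrite big1 // => j _; rewrite !andbF.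
  rewrite big_filter big_enum_cond (reindex_inj (@perm_inj _ s)) big_mkcond.
  apply: eq_bigr => j _; rewrite /= permK andbT.
  by case: (e j); rewrite ?andbT ?andbF // andbC.
- by rewrite permE odd_part_fun_odd.
- by rewrite permE /odd_part_fun (negPf ei).
Qed.

(** * Which letter comes first in a shuffle *)

Lemma shuffleP n p (s : 'S_n) :
  reflect (forall i j : 'I_n, (i < j < p) || (p <= i < j) -> s i < s j)
          (shuffle p s).
Proof. by apply: (iffP 'forall_'forall_implyP). Qed.

Lemma shuffle_first n p (s : 'S_n.+1) : shuffle p s ->
  (s^-1%g ord0 == 0 :> nat) || (s^-1%g ord0 == p :> nat).
Proof.
move=> /shuffleP sh_s; set i := s^-1%g ord0.
have si : s i = ord0 by rewrite permKV.
apply/norP => -[i0 ip].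
(* The first index of the block of [i] would have to precede [i] in the image. *)
pose j : 'I_n.+1 := if i < p then ord0 else inord p.
suff : s j < s i by rewrite si.
apply: sh_s; rewrite /j; case: (ltnP i p) => [lip | lpi].
  by rewrite lt0n i0.
have lt_pi : p < i by rewrite ltn_neqAle eq_sym ip.
by rewrite inordK ?leqnn ?lt_pi ?orbT // (ltn_trans lt_pi).
Qed.

Lemma shuffle_lift n p q (i0 : 'I_n.+1) (s : 'S_n) :
  (forall i : 'I_n.+1, ~~ ((i < i0 < q) || (q <= i < i0))) ->
  (forall i j : 'I_n,
     ((lift i0 i < lift i0 j < q) || (q <= lift i0 i < lift i0 j))
     = ((i < j < p) || (p <= i < j))) ->
  shuffle q (lift_perm i0 ord0 s) = shuffle p s.
Proof.
move=> no_i0 condE; apply/shuffleP/shuffleP => sh_s i j.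
  by rewrite -condE => /sh_s; rewrite !lift_perm_lift ltn_lift.
case: (unliftP i0 i) => [i'|] ->; case: (unliftP i0 j) => [j'|] ->.
- by rewrite condE !lift_perm_lift ltn_lift; apply: sh_s.
- by rewrite (negPf (no_i0 _)).
- by rewrite lift_perm_id lift_perm_lift.
- by rewrite (negPf (no_i0 _)).
Qed.

Lemma shuffle_lift0 n p (s : 'S_n) :
  shuffle p.+1 (lift_perm ord0 ord0 s) = shuffle p s.
Proof. by apply: shuffle_lift => [i|i j]; rewrite ?ltn0 ?andbF. Qed.

Lemma shuffle_liftp n p (i0 : 'I_n.+1) (s : 'S_n) : i0 = p :> nat ->
  shuffle p (lift_perm i0 ord0 s) = shuffle p s.
Proof.
move=> i0p; apply: shuffle_lift => [i|i j].
  by rewrite ?ltn_lift /= i0p; lia.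
rewrite ?ltn_lift /= i0p /bump.
by case: (leqP p i); case: (leqP p j); lia.
Qed.

(** * Signed shuffle sums over words *)

Local Open Scope ring_scope.

Section Shuffle.

(** [swap x y] tells whether exchanging [x] and [y] changes the sign. *)
Variables (K : fieldType) (M : lmodType K) (T : eqType) (swap : T -> T -> bool).
Implicit Types (F G : seq T -> M) (u v w : seq T) (x y : T).

Definition swaps (y : T) (u : seq T) : bool := \big[addb/false]_(x <- u) swap x y.

(** Shuffles of [u] and [v] start with the first letter of [u], or with that of
[v], which is then moved past all of [u]. *)
Fixpoint sh (u : seq T) : seq T -> (seq T -> M) -> M :=
  if u is x :: u' then
    fix shu (v : seq T) (F : seq T -> M) : M :=
      if v is y :: v' then
        sh u' v (fun w => F (x :: w))
        + (-1) ^+ swaps y u *: shu v' (fun w => F (y :: w))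
      else F u
  else fun v F => F v.

Lemma swaps_nil y : swaps y [::] = false.
Proof. by rewrite /swaps big_nil. Qed.

Lemma swaps_cons y x u : swaps y (x :: u) = swap x y (+) swaps y u.
Proof. by rewrite /swaps big_cons. Qed.

Lemma swaps_rcons y x u : swaps y (rcons u x) = swaps y u (+) swap x y.
Proof. by rewrite /swaps -cats1 big_cat big_seq1. Qed.

Lemma swaps_cat y u v : swaps y (u ++ v) = swaps y u (+) swaps y v.
Proof. exact: big_cat. Qed.

Lemma sh0l v F : sh [::] v F = F v. Proof. by []. Qed.
Lemma sh0r u F : sh u [::] F = F u. Proof. by case: u. Qed.

Lemma shE x u y v F : sh (x :: u) (y :: v) F =
  sh u (y :: v) (fun w => F (x :: w))
  + (-1) ^+ swaps y (x :: u) *: sh (x :: u) v (fun w => F (y :: w)).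
Proof. by []. Qed.

Lemma sh_ind2 (P : seq T -> seq T -> Prop) :
  (forall v, P [::] v) -> (forall u, P u [::]) ->
  (forall x u y v, P u (y :: v) -> P (x :: u) v -> P (x :: u) (y :: v)) ->
  forall u v, P u v.
Proof.
by move=> P0l P0r PS; elim=> // x u IHu; elim=> // y v IHv; apply: PS.
Qed.

Lemma sh_ext u v F G :
  (forall w, perm_eq w (u ++ v) -> F w = G w) -> sh u v F = sh u v G.
Proof.
move: u v F G; apply: sh_ind2 => [v|u|x u y v IHu IHv] F G FG.
- by apply: FG.
- by rewrite !sh0r; apply: FG; rewrite cats0.
rewrite !shE; congr (_ + _ *: _).
  by apply: IHu => w ww; apply: FG; rewrite /= perm_cons.
apply: IHv => w ww; apply: FG; rewrite -cat1s -[y :: v]cat1s.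
by rewrite perm_sym perm_catCA perm_cons perm_sym.
Qed.

Lemma shD u v F G : sh u v (fun w => F w + G w) = sh u v F + sh u v G.
Proof.
move: u v F G; apply: sh_ind2 => [//|u|x u y v IHu IHv] F G.
  by rewrite !sh0r.
by rewrite !shE IHu IHv scalerDr addrACA.
Qed.

Lemma sh_linear (h : {linear M -> M}) u v F :
  sh u v (fun w => h (F w)) = h (sh u v F).
Proof.
move: u v F; apply: sh_ind2 => [//|u|x u y v IHu IHv] F; first by rewrite !sh0r.
by rewrite !shE IHu IHv linearD linearZ.
Qed.

Lemma shZ c u v F : sh u v (fun w => c *: F w) = c *: sh u v F.
Proof. exact: (sh_linear ( *:%R c)). Qed.

(** The mirror image of the defining recursion [shE], needed for the last term
of the coboundary. *)
Lemma sh_rcons u v x y F : (forall a b, swap a b = swap b a) ->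
  sh (rcons u x) (rcons v y) F =
  (-1) ^+ swaps x (rcons v y) *: sh u (rcons v y) (fun w => F (rcons w x))
  + sh (rcons u x) v (fun w => F (rcons w y)).
Proof.
move=> swapC; move: u v F; apply: sh_ind2 => [v|u|a u b v IHu IHv] F.
- elim: v F => [|b v IH] F.
    by rewrite !shE !sh0l !sh0r !swaps_cons !swaps_nil swapC addrC.
  rewrite !rcons_cons !shE !sh0l IH scalerDr scalerA -signr_addb addrCA.
  rewrite [swaps x (b :: _)]swaps_cons [swaps b [:: x]]swaps_cons.
  by rewrite swaps_nil addbF swapC.
- elim: u F => [|a u IH] F.
    by rewrite !shE !sh0l !sh0r !swaps_cons !swaps_nil swapC addrC.
  rewrite !rcons_cons !shE IH !sh0r scalerDr scalerA -signr_addb addrAC.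
  by rewrite -rcons_cons !swaps_rcons swaps_nil addFb [swap y x]swapC addbC.
have E : rcons (b :: v) y = b :: rcons v y by [].
rewrite !rcons_cons !shE -E IHu -[a :: rcons u x]/(rcons (a :: u) x) IHv.
rewrite !scalerDr !scalerA -!signr_addb -!addrA E.
rewrite swaps_rcons [swaps x (b :: _)]swaps_cons [swap b x]swapC.
rewrite -addbA [_ (+) swaps b (a :: u)]addbC.
by congr (_ + _); rewrite addrCA.
Qed.

(** * The inner part of the coboundary is compatible with shuffles *)

(** If exchange signs have the form [-(-1)^(|x||y|)] with additive parities,
the minus sign makes [swap] multiplicative only up to a negation. *)
Variable mul : T -> T -> T.
Hypothesis swapC : forall x y, swap x y = swap y x.
Hypothesis swap_mul :
  forall x x' y, swap (mul x x') y = ~~ (swap x y (+) swap x' y).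

Fixpoint contr (i : nat) (w : seq T) {struct w} : seq T :=
  if w is x :: t then
    if t is y :: w' then
      if i is j.+1 then x :: contr j t else mul x y :: w'
    else w
  else w.

Lemma contr_eq0 i w : (contr i w == [::]) = (w == [::]).
Proof. by case: w => [|x [|y w]] //; case: i. Qed.

Lemma size_contr i w : (i < (size w).-1)%N -> size (contr i w) = (size w).-1.
Proof.
elim: w i => // x [|y w] // IH [|i] //= lti.
by rewrite -/(contr i (y :: w)) IH.
Qed.

Lemma all_contr (hom : pred T) i w :
  (forall x y, hom x -> hom y -> hom (mul x y)) ->
  all hom w -> all hom (contr i w).
Proof.
move=> hom_mul; elim: w i => // x [|y w] // IH [|i] /and3P[hx hy hw].
  by rewrite /= hom_mul.
by apply/andP; split; last by apply: IH; apply/andP.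
Qed.

Definition bar F w : M :=
  \sum_(i < (size w).-1) (-1) ^+ i.+1 *: F (contr i w).

(** The term of [bar] in which [x], put in front of [w], is multiplied with the
first letter of [w]; there is none if [w] is empty. *)
Definition headmul x F w : M := if w is y :: w' then F (mul x y :: w') else 0.

Lemma bar_nil F : bar F [::] = 0.
Proof. by rewrite /bar big_ord0. Qed.

Lemma bar_cons x F w :
  bar F (x :: w) = - headmul x F w - bar (fun w => F (x :: w)) w.
Proof.
case: w => [|y w]; first by rewrite /bar !big_ord0 subr0 oppr0.
rewrite /bar /= big_ord_recl /= scaleN1r; congr (_ + _).
rewrite -sumrN; apply: eq_bigr => i _.
by rewrite /= [in LHS]exprS mulN1r scaleNr.
Qed.

Lemma eq_bar F G w : F =1 G -> bar F w = bar G w.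
Proof. by move=> FG; apply: eq_bigr => i _; rewrite FG. Qed.

Lemma barD F G w : bar (fun w => F w + G w) w = bar F w + bar G w.
Proof. by rewrite -big_split; apply: eq_bigr => i _; rewrite scalerDr. Qed.

Lemma barZ c F w : bar (fun w => c *: F w) w = c *: bar F w.
Proof.
by rewrite scaler_sumr; apply: eq_bigr => i _; rewrite !scalerA mulrC.
Qed.

Lemma swaps_contr y i w :
  (i < (size w).-1)%N -> swaps y (contr i w) = ~~ swaps y w.
Proof.
elim: w i => // x [|z w] // IH [_|i lti].
  by rewrite /= !swaps_cons swap_mul addNb addbA.
by rewrite /= -/(contr i (z :: w)) swaps_cons IH // [in RHS]swaps_cons addbN.
Qed.

Lemma swaps_mul y z u :
  swaps (mul y z) u = odd (size u) (+) swaps y u (+) swaps z u.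
Proof.
elim: u => [|x u IH]; first by rewrite !swaps_nil.
rewrite !swaps_cons IH swapC swap_mul /= (swapC x y) (swapC x z).
by case: (swap y x); case: (swap z x); case: (odd _);
   case: (swaps y u); case: (swaps z u).
Qed.

(** A contraction removes one letter, whence the change of sign. *)
Lemma bar_swaps b y u F :
  bar (fun u => (-1) ^+ (b (+) swaps y u) *: F u) u
  = - ((-1) ^+ (b (+) swaps y u) *: bar F u).
Proof.
rewrite /bar scaler_sumr -sumrN; apply: eq_bigr => i _.
by rewrite swaps_contr // addbN signrN scaleNr scalerN !scalerA mulrC.
Qed.

(** [F] sees the product of letters satisfying [hom] as supercommutative. *)
Definition mulcomm (hom : pred T) F := forall s x y w, hom x -> hom y ->
  F (s ++ mul y x :: w) = (-1) ^+ (~~ swap x y) *: F (s ++ mul x y :: w).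

(** Shuffling the terms that begin with a product [xz]: either [z] comes from
the same word as [x], giving the first two summands, or from the other one,
giving the last. *)
Lemma sh_headmull x u y v F :
  sh u (y :: v) (headmul x F)
  = headmul x (fun u => sh u (y :: v) F) u
    + (-1) ^+ swaps y (x :: u) *:
        headmul x (fun u => sh u v (fun w => F (y :: w))) u
    + (-1) ^+ swaps y u *: sh u v (fun w => F (mul x y :: w)).
Proof.
case: u => [|x' u]; first by rewrite /= swaps_nil scaler0 scale1r !add0r.
rewrite /headmul !shE /= [in X in _ + X *: _ + _]swaps_cons !(swaps_cons y).
rewrite swap_mul addNb addbA signrN scaleNr -addrA -addrA; congr (_ + _).
by rewrite addrA addNr add0r.
Qed.

(** The same with the product starting in the second word. *)
Lemma sh_headmulr x u y v F :
  sh (x :: u) v (headmul y F)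
  = (-1) ^+ (odd (size (x :: u)) (+) swaps y (x :: u)) *:
       (headmul y (fun v => sh (x :: u) v F) v
        - headmul y (fun v => sh u v (fun w => F (x :: w))) v)
    + sh u v (fun w => F (mul y x :: w)).
Proof.
case: v => [|y' v]; first by rewrite /= subr0 scaler0 add0r sh0r.
rewrite /headmul !shE swaps_mul [in RHS]addrAC subrr add0r scalerA -signr_addb.
by rewrite addrC addbA addbb addFb.
Qed.

Lemma sh_bar (hom : pred T) u v F : mulcomm hom F -> all hom u -> all hom v ->
  sh u v (bar F) = bar (fun u => sh u v F) u
    + (-1) ^+ odd (size u) *: bar (fun v => sh u v F) v.
Proof.
move: u v F; apply: sh_ind2 => [v|u|x u y v IHu IHv] F Fc.
- by move=> _ _; rewrite bar_nil add0r scale1r.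
- move=> _ _; rewrite bar_nil scaler0 addr0 sh0r.
  by apply: eq_bar => w; rewrite sh0r.
move=> homu homv; have [/andP[hx hu] /andP[hy hv]] := (homu, homv).
have Fzc z : mulcomm hom (fun w => F (z :: w)).
  by move=> s; apply: (Fc (z :: s)).
have sh_barc z u' v' : sh u' v' (fun w => bar F (z :: w))
    = - sh u' v' (headmul z F) - sh u' v' (bar (fun w => F (z :: w))).
  rewrite -!scaleN1r -!shZ -shD; apply: sh_ext => w _.
  by rewrite bar_cons !scaleN1r.
have barl : bar (fun u => sh (x :: u) (y :: v) F) u
    = bar (fun u => sh u (y :: v) (fun w => F (x :: w))) u
      - (-1) ^+ swaps y (x :: u) *:
          bar (fun u => sh (x :: u) v (fun w => F (y :: w))) u.
  rewrite [in RHS]swaps_cons -bar_swaps -barD; apply: eq_bar => u'.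
  by rewrite shE swaps_cons.
have barr : bar (fun v => sh (x :: u) (y :: v) F) v
    = bar (fun v => sh u (y :: v) (fun w => F (x :: w))) v
      + (-1) ^+ swaps y (x :: u) *:
          bar (fun v => sh (x :: u) v (fun w => F (y :: w))) v.
  by rewrite -barZ -barD; apply: eq_bar => v'; rewrite shE.
have swapxy : sh u v (fun w => F (mul y x :: w))
    = (-1) ^+ (~~ swap x y) *: sh u v (fun w => F (mul x y :: w)).
  by rewrite -shZ; apply: sh_ext => w _; apply: (Fc [::]).
rewrite shE !sh_barc IHu // IHv // !bar_cons barl barr sh_headmull sh_headmulr.
rewrite swapxy (swaps_cons y x u) !scaler_sign /=.
(* What remains is a linear identity between nine vectors, for each choice of
   the three signs. *)
move: (sh u v _) => X.
move: (headmul _ _ _) => h1.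
move: (headmul _ _ _) => h2.
move: (headmul _ _ _) => h3.
move: (headmul _ _ _) => h4.
move: (bar _ _) => b1.
move: (bar _ _) => b2.
move: (bar _ _) => b3.
move: (bar _ _) => b4.
have cancel (a b : M) : (a == b) = (0 + (a - b) == 0) by rewrite add0r subr_eq0.
(* Each vector occurs with opposite signs: both occurrences are moved to the
   end of the sum and cancelled. *)
by case: (swap x y) (swaps y u) (odd (size u)) => [] [] [];
  apply/eqP; rewrite cancel /= !(opprD, opprK) !addrA;
  repeat match goal with |- context [_ + ?a] => is_var a;
    rewrite ?[_ + a + _]addrAC ?[_ + - a + _]addrAC ?addrK end; rewrite eqxx.
Qed.

(** * Shuffle sums over permutations *)

Variable x0 : T.

Definition perm_term n (w : seq T) (G : seq T -> M) (s : 'S_n) : M :=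
  (-1) ^+ inv_sum s (fun i j => swap (nth x0 w i) (nth x0 w j))
    *: G [seq nth x0 w (s^-1%g i) | i : 'I_n].

(** The permutations that move the letter [z] to the front. *)
Lemma sum_perm_term_lead n (a : seq T) z b G (i0 : 'I_n.+1)
    (P : pred 'S_n.+1) : i0 = size a :> nat ->
  \sum_(s | P s && (s^-1%g ord0 == i0)) perm_term (a ++ z :: b) G s
  = (-1) ^+ swaps z a *: \sum_(s | P (lift_perm i0 ord0 s))
       perm_term (a ++ b) (fun w => G (z :: w)) s.
Proof.
move=> i0a.
pose h' (s : 'S_n.+1) : 'S_n :=
  odflt 1%g [pick s' | lift_perm i0 ord0 s' == s].
have hK s : h' (lift_perm i0 ord0 s) = s.
  rewrite /h'; case: pickP => [s' /eqP /lift_perm_inj // | /(_ s)].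
  by rewrite eqxx.
rewrite (reindex_onto (lift_perm i0 ord0) h') => [|s /andP[_ /eqP si0]]; last first.
  have [s' Es] := lift_perm_ex s i0.
  by move: Es; rewrite -[in X in _ = X]si0 permKV si0 => ->; rewrite hK.
rewrite scaler_sumr; apply: eq_big => [s | s _].
  by rewrite hK eqxx andbT lift_permV lift_perm_id eqxx andbT.
have nth_i0 : nth x0 (a ++ z :: b) i0 = z by rewrite nth_cat i0a ltnn subnn.
have nth_lift (i : 'I_n) :
    nth x0 (a ++ z :: b) (lift i0 i) = nth x0 (a ++ b) i.
  rewrite /= i0a !nth_cat /bump; case: (leqP (size a) i) => ai /=.
    by rewrite add1n ltnNge leqW // subSn.
  by rewrite add0n ai.
rewrite /perm_term inv_sum_lift signr_addb -scalerA; congr (_ *: (_ *: _)).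
- congr (_ ^+ (nat_of_bool _)); rewrite /swaps (big_nth x0) big_mkord.
  rewrite -i0a (big_ord_widen n.+1 (fun k => swap (nth x0 a k) z)) 1?ltnW //.
  by apply: eq_bigr => k lt_k; rewrite nth_i0 nth_cat -i0a lt_k.
- by congr (_ ^+ (nat_of_bool _)); apply: eq_inv_sum => i j; rewrite !nth_lift.
- congr (G _); rewrite /image_mem enum_ordSl /= lift_permV lift_perm_id nth_i0.
  congr cons; rewrite -map_comp; apply: eq_map => i /=.
  by rewrite lift_perm_lift nth_lift.
Qed.

Lemma sum_shuffle n u v G : (size u + size v = n)%N ->
  \sum_(s : 'S_n | shuffle (size u) s) perm_term (u ++ v) G s = sh u v G.
Proof.
elim: n u v G => [|n IH] u v G.
  case: u => //; case: v => // _; rewrite (big_pred1 1%g) => [|s].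
    rewrite /perm_term /inv_sum big_ord0 scale1r.
    by congr (G _); rewrite /image_mem enum_ord0.
  have -> : s = 1%g by apply/permP => -[].
  by rewrite /= eqxx; apply/shuffleP => -[].
case: u => [|x u].
  case: v => // y v [sz].
  rewrite (eq_bigl (fun s => shuffle 0 s && (s^-1%g ord0 == ord0))) => [|s];
    last first.
    case: (boolP (shuffle 0 s)) => // /shuffle_first.
    by rewrite -val_eqE /= orbb => ->.
  rewrite -[[::] ++ _]/([::] ++ y :: v) sum_perm_term_lead //.
  rewrite swaps_nil scale1r.
  rewrite -[RHS]/(sh [::] v (fun w => G (y :: w))) -IH //.
  by apply: eq_bigl => s; rewrite shuffle_liftp.
case: v => [|y v].
  rewrite addn0 => -[sz].
  rewrite (eq_bigl (fun s => shuffle (size u).+1 s && (s^-1%g ord0 == ord0)))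
    => [|s]; last first.
    case: (boolP (shuffle _ s)) => // /shuffle_first.
    by rewrite /= sz (ltn_eqF (ltn_ord _)) orbF -val_eqE => ->.
  rewrite -[(x :: u) ++ _]/([::] ++ x :: (u ++ [::])) sum_perm_term_lead //.
  rewrite swaps_nil scale1r -[RHS]/(G (x :: u)).
  rewrite -[RHS](sh0r u (fun w => G (x :: w))) -IH ?addn0 //.
  by apply: eq_bigl => s; rewrite shuffle_lift0.
move=> /= [sz]; rewrite -/(sh (x :: u) v) -[RHS]/(sh (x :: u) (y :: v) G) shE.
rewrite (bigID (fun s : 'S_n.+1 => s^-1%g ord0 == ord0)); congr (_ + _).
  rewrite -[x :: _]/([::] ++ x :: (u ++ y :: v)) sum_perm_term_lead //.
  rewrite swaps_nil scale1r -IH //.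
  by apply: eq_bigl => s; rewrite shuffle_lift0.
have lt_u : ((size u).+1 < n.+1)%N by rewrite -sz /= addnS ltnS leq_addr.
rewrite (eq_bigl (fun s => shuffle (size u).+1 s
                           && (s^-1%g ord0 == Ordinal lt_u))) => [|s]; last first.
  case: (boolP (shuffle _ s)) => // /shuffle_first.
  by rewrite -!val_eqE /=; case: eqP => [->|_] //= ->.
rewrite -cat_cons sum_perm_term_lead // -IH; last by rewrite -sz addnS.
by congr (_ *: _); apply: eq_bigl => s; rewrite shuffle_liftp.
Qed.

End Shuffle.

(** * Words in a supercommutative algebra *)

Section Letters.

Variables (K : fieldType) (A : superAlgebra K) (M : superModule A).
Local Notation letter := (bool * A)%type.
Implicit Types (x y z : letter) (u v w : seq letter) (F : seq letter -> M).

(** The exchange sign is [-(-1)^(|x||y|)]: the signature of the transposition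
times the Koszul sign. *)
Definition swap_letter x y := ~~ (x.1 && y.1).
Definition mul_letter x y := (x.1 (+) y.1, sa_mul A x.2 y.2).
Definition homog x := x.2 \in sa_grade A x.1.
Definition parity w := \big[addb/false]_(x <- w) x.1.

Local Notation shuffle_sum := (sh swap_letter).

Lemma swap_letterC x y : swap_letter x y = swap_letter y x.
Proof. by rewrite /swap_letter andbC. Qed.

Lemma swap_letter_mul x x' y :
  swap_letter (mul_letter x x') y = ~~ (swap_letter x y (+) swap_letter x' y).
Proof. by rewrite /swap_letter /= andb_addl addNb addbN negbK. Qed.

Lemma homog_mul x y : homog x -> homog y -> homog (mul_letter x y).
Proof. exact: sa_mul_grade. Qed.

Definition last_term F w : M :=
  if w is x :: t then
    (-1) ^+ size w *: sm_ract (F (belast x t)) (last x t).2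
  else 0.

Definition word_coboundary F w : M :=
  if w is x :: t then
    sm_act M x.2 (F t) + bar mul_letter F w + last_term F w
  else 0.

Lemma last_term_rcons F w z :
  last_term F (rcons w z) = (-1) ^+ (size w).+1 *: sm_ract (F w) z.2.
Proof. by case: w => [|x w] //=; rewrite belast_rcons last_rcons size_rcons. Qed.

Lemma swaps_parity z w :
  swaps swap_letter z w = odd (size w) (+) (z.1 && parity w).
Proof.
elim: w => [|x w IH]; first by rewrite swaps_nil /parity big_nil andbF.
rewrite swaps_cons IH /parity big_cons /swap_letter /=.
by case: z.1; case: x.1; case: odd; case: (\big[_/_]_(_ <- _) _).
Qed.

Lemma perm_parity w w' : perm_eq w w' -> parity w = parity w'.
Proof. exact: perm_big. Qed.

(** The right action of [z] on [F w] is the left action times the sign for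
moving [z] past [w], and [(-1)^(size w).+1] provides the minus signs that
turn it into the exchange sign of [z] with all of [w], up to a global minus. *)
Lemma sh_last_term F u v z :
  (forall w, all homog w -> F w \in sm_grade M (parity w)) ->
  homog z -> all homog (u ++ v) ->
  shuffle_sum u v (fun w => last_term F (rcons w z))
  = - ((-1) ^+ swaps swap_letter z (u ++ v)
         *: sm_act M z.2 (shuffle_sum u v F)).
Proof.
move=> Fpar hz huv; rewrite -scaleNr -!sh_linear.
apply: sh_ext => w ww.
rewrite last_term_rcons (sm_ractE hz (Fpar w _)) ?(perm_all _ ww) //.
rewrite swaps_parity -(perm_size ww) -(perm_parity ww) scalerA.
by rewrite signr_addb signr_odd exprS mulN1r mulNr.
Qed.

(** The statement for words.  The contracted terms vanish by [sh_bar].  In the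
outer terms only words [u] or [v] with a single letter contribute, and there
the terms with that letter at the front and at the end cancel. *)
Lemma sh_word_coboundary F u v :
    mulcomm swap_letter mul_letter homog F ->
    (forall w, all homog w -> F w \in sm_grade M (parity w)) ->
    (forall u v, u != [::] -> v != [::] -> all homog u -> all homog v ->
       shuffle_sum u v F = 0) ->
  u != [::] -> v != [::] -> all homog u -> all homog v ->
  shuffle_sum u v (word_coboundary F) = 0.
Proof.
move=> Fc Fpar Fsh.
case: (lastP u) => // u' x nu; case: (lastP v) => // v' y nv hu hv.
pose head w := if w is z :: t then sm_act M z.2 (F t) else 0.
have -> : shuffle_sum (rcons u' x) (rcons v' y) (word_coboundary F)
        = shuffle_sum (rcons u' x) (rcons v' y) head
          + shuffle_sum (rcons u' x) (rcons v' y) (last_term F).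
  rewrite -[RHS]addr0.
  have <- : shuffle_sum (rcons u' x) (rcons v' y) (bar mul_letter F) = 0.
    rewrite (sh_bar swap_letterC swap_letter_mul Fc) // /bar.
    rewrite !big1 ?scaler0 ?addr0 // => i _.
      by rewrite Fsh ?scaler0 ?contr_eq0 ?nu ?nv ?all_contr //; apply: homog_mul.
    by rewrite Fsh ?scaler0 ?contr_eq0 ?nu ?nv ?all_contr //; apply: homog_mul.
  rewrite addrAC -!shD; apply: sh_ext => -[|z w] _ /=; last by [].
  by rewrite bar_nil !addr0.
rewrite [X in _ + X]sh_rcons; last exact: swap_letterC.
move: (hu) (hv); rewrite !all_rcons => /andP[hx hu'] /andP[hy hv'].
rewrite !(sh_last_term Fpar) ?all_cat ?all_rcons ?hu' ?hv' ?hx ?hy //.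
clear nu nv.
(* With [a :: u1 = rcons u' x]: both sides vanish unless [u' = [::]], when
   [a = x] and [u1 = u']. *)
have headL :
    sm_act M (seq.head x u').2 (shuffle_sum (behead (rcons u' x)) (rcons v' y) F)
    = (-1) ^+ swaps swap_letter x u' *:
        sm_act M x.2 (shuffle_sum u' (rcons v' y) F).
  case: u' hu hu' => [|a u'] hu hu'; first by rewrite swaps_nil scale1r.
  have hu0 : all homog (rcons u' x) by case/andP: hu.
  by rewrite !Fsh ?linear0r ?scaler0 //; [case: (v')|case: (u')|case: (v')].
have headR :
    (-1) ^+ swaps swap_letter (seq.head y v') (rcons u' x) *:
      sm_act M (seq.head y v').2
        (shuffle_sum (rcons u' x) (behead (rcons v' y)) F)
    = (-1) ^+ swaps swap_letter y (rcons u' x ++ v') *: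
        sm_act M y.2 (shuffle_sum (rcons u' x) v' F).
  case: v' hv hv' {headL} => [|a v'] hv hv'; first by rewrite cats0.
  have hv0 : all homog (rcons v' y) by case/andP: hv.
  by rewrite !Fsh ?linear0r ?scaler0 //; [case: (u')|case: (u')|case: (v')].
have -> : shuffle_sum (rcons u' x) (rcons v' y) head =
    sm_act M (seq.head x u').2 (shuffle_sum (behead (rcons u' x)) (rcons v' y) F)
    + (-1) ^+ swaps swap_letter (seq.head y v') (rcons u' x) *:
        sm_act M (seq.head y v').2
          (shuffle_sum (rcons u' x) (behead (rcons v' y)) F).
  rewrite (headI u') (headI v') shE.
  by rewrite -!(sh_linear _ (sm_act M _)).
rewrite headL headR [swaps _ x (u' ++ _)]swaps_cat scalerN scalerA -signr_addb.
rewrite addbCA addbb addbF.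
by rewrite addrACA !subrr addr0.
Qed.

(** * Cochains as functions of words *)

Local Notation x0 := (false, 0 : sa_sort A).

Definition values n w : {ffun 'I_n -> A} := [ffun i : 'I_n => (nth x0 w i).2].
Definition parities n w : {ffun 'I_n -> bool} :=
  [ffun i : 'I_n => (nth x0 w i).1].
Definition word n (e : {ffun 'I_n -> bool}) (a : {ffun 'I_n -> A}) :
    seq letter :=
  [seq (e i, a i) | i : 'I_n].

(** Zero on words of the wrong length, so that the hypotheses of
[sh_word_coboundary] hold for all words. *)
Definition on_words n (f : {ffun 'I_n -> A} -> M) w : M :=
  if size w == n then f (values n w) else 0.

Section Words.

Variable n : nat.
Implicit Types (e : {ffun 'I_n -> bool}) (a : {ffun 'I_n -> A}).
Implicit Types (f : {ffun 'I_n -> A} -> M).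

Lemma size_word e a : size (word e a) = n.
Proof. by rewrite size_image card_ord. Qed.

Lemma nth_word e a (i : 'I_n) : nth x0 (word e a) i = (e i, a i).
Proof. by rewrite (nth_map i) ?size_enum_ord // -?enumT nth_ord_enum. Qed.

Lemma values_word e a : values n (word e a) = a.
Proof. by apply/ffunP => i; rewrite ffunE nth_word. Qed.

Lemma word_values w : size w = n -> word (parities n w) (values n w) = w.
Proof.
move=> sz; apply: (@eq_from_nth _ x0); rewrite size_word // => i lti.
by rewrite (nth_word _ _ (Ordinal lti)) !ffunE; case: nth.
Qed.

Lemma on_words_word f e a : on_words f (word e a) = f a.
Proof. by rewrite /on_words size_word eqxx values_word. Qed.

Lemma all_homog_word e a :
  (forall i, a i \in sa_grade A (e i)) -> all homog (word e a).
Proof. by move=> ae; apply/allP => _ /imageP[i _ ->]; apply: ae. Qed.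

Lemma parity_word e a : parity (word e a) = \big[addb/false]_(i < n) e i.
Proof. by rewrite /parity big_image. Qed.

(** The signature and the Koszul sign combine to the exchange sign of each
inverted pair of letters. *)
Lemma su_homog_sh p f e a : (p <= n)%N ->
  su_homog p f e a =
  shuffle_sum (take p (word e a)) (drop p (word e a)) (on_words f).
Proof.
move=> lepn; rewrite -(@sum_shuffle _ _ _ _ x0 n); last first.
  by rewrite -size_cat cat_take_drop size_word.
rewrite size_takel ?size_word // cat_take_drop; apply: eq_bigr => s _.
rewrite /perm_term; congr (_ *: _).
  rewrite -signr_addb odd_perm_inv_sum odd_part_inv_sum /inv_sum -big_split /=.
  congr (_ ^+ (nat_of_bool _)); apply: eq_bigr => i _; rewrite -big_split /=.
  apply: eq_bigr => j _; rewrite !nth_word /swap_letter /=.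
  by case: (_ < _)%N => //=; case: (_ < _)%N.
rewrite -(on_words_word f [ffun i => e (s^-1%g i)]); congr on_words.
by apply: eq_map => i /=; rewrite !ffunE nth_word.
Qed.

Lemma multilinearZ f a i c (x : A) : multilinear f ->
  f (upd a i (c *: x)) = c *: f (upd a i x).
Proof.
move=> fl; rewrite -[c *: x]addr0 fl.
rewrite [f (upd a i 0)](@multilinear0 _ _ _ _ _ _ i) ?addr0 //.
by rewrite ffunE eqxx.
Qed.

Lemma on_words_mulcomm f : multilinear f ->
  mulcomm swap_letter mul_letter homog (on_words f).
Proof.
move=> fl s x y w hx hy; rewrite /on_words !size_cat /=.
case: eqP => [sz|_]; last by rewrite scaler0.
have lts : (size s < n)%N by rewrite -sz addnS ltnS leq_addr.
set b := values n (s ++ mul_letter x y :: w).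
have valuesE z : values n (s ++ z :: w) = upd b (Ordinal lts) z.2.
  apply/ffunP => i; rewrite !ffunE -val_eqE /= !nth_cat.
  case: (ltngtP i (size s)) => [||->] //=; last by rewrite subnn.
  by move=> lti; rewrite -(subnSK lti).
rewrite valuesE -[b in RHS]/(values n (s ++ mul_letter x y :: w)) valuesE /=.
rewrite (sa_supercomm hx hy) multilinearZ //.
by rewrite /swap_letter negbK.
Qed.

Lemma on_words_parity f : parity_preserving f ->
  forall w, all homog w -> on_words f w \in sm_grade M (parity w).
Proof.
move=> fp w hw; rewrite /on_words; case: eqP => [sz|_]; last exact: rpred0.
rewrite -[in parity w](word_values sz) parity_word; apply: fp => i; rewrite !ffunE.
by apply: (allP hw); rewrite mem_nth ?sz.
Qed.

Lemma sh_on_words f : super_harrison f -> forall u v, u != [::] -> v != [::] ->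
  all homog u -> all homog v -> shuffle_sum u v (on_words f) = 0.
Proof.
move=> [fl _ fsu] u v nu nv hu hv.
have [sz|nsz] := eqVneq (size u + size v)%N n; last first.
  rewrite -[RHS](scale0r (shuffle_sum u v (on_words f))) -shZ.
  apply: sh_ext => w /perm_size; rewrite size_cat /on_words scale0r => ->.
  by rewrite (negPf nsz).
have sz' : size (u ++ v) = n by rewrite size_cat.
rewrite -[u in LHS](take_size_cat v erefl).
rewrite -[v in X in sh _ _ X](drop_size_cat v (erefl (size u))).
rewrite -(word_values sz') -su_homog_sh; last by rewrite -sz leq_addr.
rewrite -suE // => [|i]; last first.
  rewrite !ffunE; apply: (@allP _ homog (u ++ v)); first by rewrite all_cat hu.
  by rewrite mem_nth ?sz'.
apply: fsu; rewrite lt0n size_eq0 nu /= -sz.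
by move: nv; rewrite -size_eq0; case: (size v) => // k _; rewrite addnS leq_addr.
Qed.

End Words.

Lemma nth_contr n (w : seq letter) (i j : nat) : size w = n.+1 -> (i < n)%N ->
  nth x0 (contr mul_letter i w) j =
    if (j < i)%N then nth x0 w j else
    if j == i then mul_letter (nth x0 w i) (nth x0 w i.+1) else nth x0 w j.+1.
Proof.
elim: n w i j => // n IH [|x [|y w]] //= i j [sz]; case: i => [|i] lti.
  by case: j.
case: j => [|j]; first by [].
by rewrite -[LHS]/(nth x0 (contr mul_letter i (y :: w)) j) IH /= ?sz.
Qed.

Lemma parity_contr i w : parity (contr mul_letter i w) = parity w.
Proof.
rewrite /parity; elim: w i => // x [|y w] // IH [|i].
  by rewrite /= !big_cons addbA.
rewrite -[contr _ _ _]/(x :: contr mul_letter i (y :: w)).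
by rewrite big_cons IH !big_cons.
Qed.

Lemma on_words_coboundary n (f : {ffun 'I_n -> A} -> M) w : size w = n.+1 ->
  on_words (coboundary f) w = word_coboundary (on_words f) w.
Proof.
case: w => // x t [sz]; rewrite {1}/on_words /= sz eqxx /coboundary.
congr (_ + _ + _).
- rewrite ffunE /on_words sz eqxx; congr (sm_act M _ (f _)).
  by apply/ffunP => j; rewrite !ffunE.
- rewrite /bar -[(size (x :: t)).-1]/(size t) sz.
  apply: eq_bigr => i _.
  have lti : (i < (size (x :: t)).-1)%N by rewrite /= sz.
  rewrite /on_words size_contr // -[(size (x :: t)).-1]/(size t) sz eqxx.
  congr (_ *: f _).
  apply/ffunP => j; rewrite !ffunE (@nth_contr n) ?ffunE -?val_eqE /= ?sz //.
  by case: ltnP => // _; case: eqP.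
rewrite /on_words size_belast sz eqxx; congr (_ *: sm_ract (f _) _).
  apply/ffunP => j; rewrite !ffunE /= lastI nth_rcons size_belast sz.
  by rewrite ltn_ord.
by rewrite ffunE -[last x t]/(last x0 (x :: t)) -nth_last [in RHS]/= sz.
Qed.

Lemma word_coboundary_parity (F : seq letter -> M) w :
  (forall w, all homog w -> F w \in sm_grade M (parity w)) ->
  all homog w -> word_coboundary F w \in sm_grade M (parity w).
Proof.
move=> Fpar hw; case: w hw => [|x t] hw; first exact: rpred0.
have [hx ht] := andP hw; rewrite /word_coboundary !rpredD //.
- by rewrite /parity big_cons; apply: sm_act_grade => //; apply: Fpar.
- rewrite /bar rpred_sum // => i _; rewrite rpredZ //.
  rewrite -(parity_contr i); apply: Fpar.
  by apply: all_contr => //; apply: homog_mul.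
rewrite lastI last_term_rcons rpredZ //.
move: hw; rewrite lastI all_rcons => /andP[hl hb].
rewrite (sm_ractE hl (Fpar _ hb)) rpredZ //.
rewrite /parity -cats1 big_cat big_seq1 /= addbC.
by apply: sm_act_grade => //; apply: Fpar.
Qed.

(** * Multilinearity of the coboundary *)

Lemma sm_ract_linearl (a : A) (c : K) (m m' : M) :
  sm_ract (c *: m + m') a = c *: sm_ract m a + sm_ract m' a.
Proof.
rewrite /sm_ract scaler_sumr -big_split; apply: eq_bigr => i _ /=.
rewrite scaler_sumr -big_split; apply: eq_bigr => j _ /=.
by rewrite part_linear linearPr scalerDr !scalerA mulrC.
Qed.

Lemma sm_ract_linearr (a b : A) (c : K) (m : M) :
  sm_ract m (c *: a + b) = c *: sm_ract m a + sm_ract m b.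
Proof.
rewrite /sm_ract scaler_sumr -big_split; apply: eq_bigr => i _ /=.
rewrite scaler_sumr -big_split; apply: eq_bigr => j _ /=.
by rewrite part_linear linearPl scalerDr !scalerA mulrC.
Qed.

Lemma contract_upd n (a : {ffun 'I_n.+1 -> A}) (i : 'I_n) (k : 'I_n.+1) :
  exists j : 'I_n, exists2 h : A -> A, linear h &
    forall x : A, contract i (upd a k x) = upd (contract i a) j (h x).
Proof.
case: (ltngtP k i) => [lt_ki | lt_ik | eq_ki].
- have ltk : (k < n)%N by apply: ltn_trans lt_ki _.
  exists (Ordinal ltk), id => // x; apply/ffunP => j.
  rewrite !ffunE -!val_eqE /= /bump /= !add1n.
  case: (ltngtP j i) => ji; case: (ltngtP j k) => jk //=.
  all: do ?[case: eqP => //; try lia].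
- have ltk : (k.-1 < n)%N by have := ltn_ord k; lia.
  case: (eqVneq (k : nat) i.+1) => [ki | nki].
    exists i, (sa_mul A (a (widen_ord (leqnSn n) i))); first exact: linearPr.
    move=> x; apply/ffunP => j; rewrite !ffunE -!val_eqE /= /bump /= !add1n.
    by case: (ltngtP j i) => ji //=; do ?[case: eqP => //; try lia].
  exists (Ordinal ltk), id => // x; apply/ffunP => j.
  rewrite !ffunE -!val_eqE /= /bump /= !add1n.
  by case: (ltngtP j i) => ji; do ?[case: eqP => //; try lia].
exists i, (fun x : A => sa_mul A x (a (lift ord0 i))).
  by move=> c x y; rewrite linearPl.
move=> x; apply/ffunP => j; rewrite !ffunE -!val_eqE /= /bump /= !add1n.
by case: (ltngtP j i) => ji //=; do ?[case: eqP => //; try lia].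
Qed.

Lemma tail_upd n (a : {ffun 'I_n.+1 -> A}) (k : 'I_n.+1) (x : A) :
  [ffun j : 'I_n => upd a k x (lift ord0 j)] =
  if unlift ord0 k is Some j then upd [ffun j => a (lift ord0 j)] j x
  else [ffun j => a (lift ord0 j)].
Proof.
apply/ffunP => i; case: unliftP => [j ->|->]; rewrite !ffunE.
  by rewrite (inj_eq lift_inj).
by rewrite eq_sym (negPf (neq_lift _ _)).
Qed.

Lemma init_upd n (a : {ffun 'I_n.+1 -> A}) (k : 'I_n.+1) (x : A) :
  [ffun j : 'I_n => upd a k x (widen_ord (leqnSn n) j)] =
  if unlift ord_max k is Some j then upd [ffun j => a (widen_ord (leqnSn n) j)] j x
  else [ffun j => a (widen_ord (leqnSn n) j)].
Proof.
have E (j : 'I_n) : widen_ord (leqnSn n) j = lift ord_max j.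
  by apply: val_inj; rewrite [RHS]lift_max.
apply/ffunP => i; case: unliftP => [j ->|->]; rewrite !ffunE E.
  by rewrite (inj_eq lift_inj).
by rewrite eq_sym (negPf (neq_lift _ _)).
Qed.

Lemma coboundary_multilinear n (f : {ffun 'I_n -> A} -> M) :
  multilinear f -> multilinear (coboundary f).
Proof.
move=> fl a k c x y; rewrite /coboundary !scalerDr !(addrACA _ _ (_ + _)).
rewrite [X in _ = X + _]addrACA; congr (_ + _ + _).
- rewrite !tail_upd; case: unliftP => [j ->|->]; rewrite !ffunE.
    by rewrite (negPf (neq_lift _ _)) fl linearPr.
  by rewrite eqxx linearPl.
- rewrite scaler_sumr -big_split; apply: eq_bigr => i _ /=.
  have [j [h hl hE]] := contract_upd a i k.
  by rewrite !hE hl fl scalerDr !scalerA mulrC.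
rewrite scalerA mulrC -scalerA -scalerDr; congr (_ *: _).
rewrite !init_upd; case: unliftP => [j ->|->]; rewrite !ffunE.
  by rewrite (negPf (neq_lift _ _)) fl sm_ract_linearl.
by rewrite eqxx sm_ract_linearr.
Qed.

(** * The coboundary of a super-Harrison cochain *)

Lemma super_harrison_coboundary n (f : {ffun 'I_n -> A} -> M) :
  super_harrison f -> super_harrison (coboundary f).
Proof.
move=> fH; have [fl fp _] := fH.
have parf := on_words_parity fp.
split; first exact: coboundary_multilinear.
- move=> e a ae.
  rewrite -(on_words_word (coboundary f) e a) -(parity_word e a).
  rewrite on_words_coboundary ?size_word //.
  by apply: word_coboundary_parity => //; apply: all_homog_word.
move=> p /andP[p_gt0 lepn] a; rewrite /su big1 // => e _.
rewrite su_homog_sh; last exact: leqW.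
set w := word e _.
have sz : size w = n.+1 by rewrite size_word.
have hw : all homog w by apply: all_homog_word => i; rewrite ffunE part_in.
move: hw; rewrite -{1}(cat_take_drop p w) all_cat => /andP[hu hv].
rewrite (_ : sh _ _ _ _
  = shuffle_sum (take p w) (drop p w) (word_coboundary (on_words f))).
  apply: sh_word_coboundary => //; first exact: on_words_mulcomm.
  - exact: sh_on_words.
  - by rewrite -size_eq0 size_takel ?sz ?(leqW lepn) // -lt0n.
  - by rewrite -size_eq0 size_drop sz subn_eq0 -ltnNge ltnS.
apply: sh_ext => w' /perm_size; rewrite cat_take_drop sz.
exact: on_words_coboundary.
Qed.

End Letters.

Local Open Scope complex_scope.

Theorem theorem2p15 (R : realType) (A : superAlgebra R[i]) (M : superModule A)
    (n : nat) (f : {ffun 'I_n -> A} -> M) :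
  super_harrison f -> super_harrison (coboundary f).
Proof. exact: super_harrison_coboundary. Qed.
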